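(* Let $M(p)=\#\{q_p(u):\ 0\le u\le p-1\}$ be the image size of $u\mapsto q_p(u)$ on $\{0,\ldots,p-1\}$. Then $M(p)\ge (1+o(1))\,\frac{p}{(\log p)^2}$ as $p\to\infty$ over primes $p$.
   Context: For a prime $p$ and an integer $u$ with $\gcd(u,p)=1$, the Fermat quotient $q_p(u)$ is the unique integer with $q_p(u)\equiv (u^{p-1}-1)/p \pmod p$ and $0\le q_p(u)\le p-1$; also $q_p(kp)=0$ for all $k\in\mathbb{Z}$. *)

(* Defs.v *)
From Stdlib Require Import Reals.
From mathcomp Require Import all_boot.

(* Fermat quotient q_p(u): for p not dividing u, the residue in [0, p-1] of
   (u^(p-1) - 1)/p mod p (an exact division by Fermat's little theorem);
   q_p(u) = 0 when p divides u. *)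
Definition fermat_quotient (p u : nat) : nat :=
  if p %| u then 0 else ((u ^ (p - 1) - 1) %/ p) %% p.

Definition M (p : nat) : nat :=
  size (undup [seq fermat_quotient p u | u <- iota 0 p]).

Example fq_test : (fermat_quotient 3 2, fermat_quotient 5 2, M 5) = (1, 3, 3). Proof. reflexivity. Qed.

(* Main.v *)
(** Cauchy-Schwarz over a set [A] of integers in [1, p) gives [#|A|^2 <= M p * C], where
    [C] counts the collisions [q_p(u) = q_p(v)] in [A].  Since a [p]-th power residue
    modulo [p^2] is determined modulo [p], the residue of [u / v] modulo [p] of a collision
    determines [u / v] modulo [p^2], and hence as a rational number because [u, v < p].
    Taking for [A] the primes below [p] already gives [M p >= (1 + o(1)) pi(p)^2 / p], but
    the constant 1 would then require the prime number theorem.  Instead, every odd prime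
    [l] gets weight 2 and every double [2 l] gets weight 1.  Then [A] has weight
    [2 pi(p) + pi(p / 2)], and a rational number is a ratio of elements of [A] with
    distinct primes [l] with total weight at most [2^2 + 1^2 = 5], so that
    [C <= 5 p + O(#|A|)].  Compared with primes alone this gains the factor
    [(2 + 1/2)^2 / 5 = 5/4], which absorbs the loss in Chebyshev's bound
    [pi(x) >= 0.9 x / ln x], read off from the factorial ratio
    [(30n)! n! / ((15n)! (10n)! (6n)!)]: indeed [0.9^2 * 5/4 > 1]. *)

Require Import Defs.
From Stdlib Require Import Reals Lra.
From mathcomp Require Import all_boot zify.

(* MathComp also uses the key [R], for [ring_scope]. *)
Delimit Scope R_scope with R.

Set Implicit Arguments.
Unset Strict Implicit.
Unset Printing Implicit Defensive.

(** * Fermat quotients and congruences modulo p^2 *)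

Lemma eqn_mod_mul2r (d x y z : nat) :
  coprime d z -> (x * z == y * z %[mod d]) = (x == y %[mod d]).
Proof.
move=> cdz; wlog le_yx : x y / y <= x.
  move=> W; case: (leqP y x) => [/W //|/ltnW /W].
  by rewrite eq_sym => ->; rewrite eq_sym.
by rewrite !eqn_mod_dvd ?leq_mul2r ?le_yx ?orbT // -mulnBl Gauss_dvdl.
Qed.

Lemma fermat_little_unit (p u : nat) :
  prime p -> ~~ (p %| u) -> u ^ p.-1 = 1 %[mod p].
Proof.
move=> pp pu; apply/eqP; rewrite -(@eqn_mod_mul2r p _ _ u) ?prime_coprime //.
by rewrite -expnSr prednK ?prime_gt0 // mul1n; apply/eqP/fermat_little.
Qed.

Lemma fermat_quotient_eq (p u v : nat) :
    prime p -> ~~ (p %| u) -> ~~ (p %| v) ->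
    fermat_quotient p u = fermat_quotient p v ->
  u ^ p.-1 = v ^ p.-1 %[mod p ^ 2].
Proof.
move=> pp pu pv; rewrite /fermat_quotient (negPf pu) (negPf pv) (subn1 p) => Euv.
have pE w : ~~ (p %| w) -> w ^ p.-1 = p * ((w ^ p.-1 - 1) %/ p) + 1.
  move=> pw; have w_gt0 : 0 < w by case: w pw => //; rewrite dvdn0.
  have dvd : p %| w ^ p.-1 - 1.
    by rewrite -eqn_mod_dvd ?expn_gt0 ?w_gt0 //; apply/eqP/fermat_little_unit.
  by rewrite mulnC divnK // subnK // expn_gt0 w_gt0.
rewrite (pE u) // (pE v) //; apply/eqP; rewrite eqn_modDr -mulnn.
by rewrite -!muln_modr Euv.
Qed.

(** In x^p - y^p = (x - y) * S, the cofactor S is a sum of p terms that agree modulo p, so p divides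
    both factors. *)
Lemma eq_expn_prime (p x y : nat) :
  x = y %[mod p] -> x ^ p = y ^ p %[mod p ^ 2].
Proof.
wlog le_yx : x y / y <= x.
  by move=> W; case: (leqP y x) => [/W //|/ltnW /W W' /esym/W'].
move=> /eqP; rewrite eqn_mod_dvd // => dvd.
apply/eqP; rewrite eqn_mod_dvd; last by case: (p) => // n; rewrite leq_exp2r.
rewrite subn_exp -mulnn dvdn_mul //.
have xy : x = y %[mod p] by apply/eqP; rewrite eqn_mod_dvd.
rewrite /dvdn -modn_summ; under eq_bigr => i _.
  rewrite -modnMm -(modnXm _ _ x) xy modnXm modnMm -expnD.
  have -> : p.-1 - i + i = p.-1 by case: i => i /=; lia.
  over.
by rewrite sum_nat_const card_ord modnMr.
Qed.

(** Modulo p^2, x * x^(p-1) = x^p = y^p = y * x^(p-1), and the unit x^(p-1) cancels. *)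
Lemma eq_mod_prime_lift (p x y : nat) :
    prime p -> ~~ (p %| x) ->
    x = y %[mod p] -> x ^ p.-1 = y ^ p.-1 %[mod p ^ 2] ->
  x = y %[mod p ^ 2].
Proof.
move=> pp px xy xyX; apply/eqP.
rewrite -(@eqn_mod_mul2r _ _ _ (x ^ p.-1)); last first.
  by rewrite coprime_pexpl // coprimeXr // prime_coprime.
rewrite -expnS prednK ?prime_gt0 // -(modnMmr y) xyX modnMmr -expnS.
by rewrite prednK ?prime_gt0 //; apply/eqP/eq_expn_prime.
Qed.

(* The two sides agree modulo [p], hence modulo [p^2], and both are below [p^2]. *)
Lemma collision_ratio (p u v u' v' : nat) :
    prime p -> 0 < u < p -> 0 < v < p -> 0 < u' < p -> 0 < v' < p ->
    fermat_quotient p u = fermat_quotient p v ->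
    fermat_quotient p u' = fermat_quotient p v' ->
    u * v ^ (p - 2) = u' * v' ^ (p - 2) %[mod p] ->
  u * v' = u' * v.
Proof.
move=> pp hu hv hu' hv' q1 q2 er.
have nd w : 0 < w < p -> ~~ (p %| w).
  by move=> /andP[w0 wp]; rewrite gtnNdvd.
(* [w ^ (p - 2)] acts as the inverse of [w], so the last hypothesis compares u / v with u' / v'
   modulo p. *)
have vX w : 0 < w < p -> w * w ^ (p - 2) = 1 %[mod p].
  move=> hw; rewrite -expnS; have -> : (p - 2).+1 = p.-1 by have := prime_gt1 pp; lia.
  exact/fermat_little_unit/nd.
have modp : u * v' = u' * v %[mod p].
  apply/eqP; rewrite -(@eqn_mod_mul2r _ _ _ (v ^ (p - 2))); last first.
    by rewrite coprimeXr // prime_coprime ?nd.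
  rewrite -(mulnA u') -(modnMmr u') vX // modnMmr muln1.
  rewrite mulnAC -modnMml er modnMml -mulnA (mulnC _ v') -modnMmr vX //.
  by rewrite modnMmr muln1.
have le2 w z : 0 < w < p -> 0 < z < p -> w * z < p ^ 2.
  by move=> /andP[_ wp] /andP[_ zp]; rewrite -mulnn ltn_mul.
have : u * v' = u' * v %[mod p ^ 2].
  apply: eq_mod_prime_lift => //.
    by rewrite Euclid_dvdM // negb_or !nd.
  rewrite !expnMn -modnMm (fermat_quotient_eq pp (nd _ hu) (nd _ hv) q1).
  by rewrite -(fermat_quotient_eq pp (nd _ hu') (nd _ hv') q2) modnMm mulnC.
by rewrite !modn_small ?le2.
Qed.

(** * Cauchy-Schwarz and fiber counting *)

Lemma card_sqr_le_collisions (T : finType) (V : eqType) (A : {set T})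
    (h : T -> V) (s : seq V) :
    uniq s -> (forall x, x \in A -> h x \in s) ->
  #|A| ^ 2 <= size s *
    #|[set xy : T * T | [&& xy.1 \in A, xy.2 \in A & h xy.1 == h xy.2]]|.
Proof.
move=> us hs; pose n a := \sum_(x in A) (h x == a).
have ind x : x \in A -> \sum_(a <- s) (h x == a) = 1.
  move=> /hs hx; rewrite (bigD1_seq (h x)) //= eqxx big1 ?addn0 // => a.
  by rewrite eq_sym => /negPf->.
have -> : #|A| = \sum_(a <- s) n a.
  by rewrite exchange_big /= -sum1_card; apply: eq_bigr => x /ind->.
set C := [set _ | _].
have -> : #|C| = \sum_(a <- s) n a ^ 2.
  under eq_bigr => a _ do rewrite -mulnn /n big_distrlr.
  rewrite exchange_big /= -sum1_card.
  rewrite (eq_bigl (fun xy : T * T =>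
    (xy.1 \in A) && ((xy.2 \in A) && (h xy.1 == h xy.2)))); last first.
    by move=> xy; rewrite inE.
  rewrite -(pair_big_dep (mem A) (fun x y => (y \in A) && (h x == h y))
    (fun _ _ => 1)) /=.
  apply: eq_bigr => x xA; rewrite exchange_big /= big_mkcondr.
  apply: eq_bigr => y yA; case: eqP => [<-|nxy].
    by under eq_bigr => a _ do rewrite mulnb andbb; rewrite ind.
  rewrite big1 // => a _; rewrite mulnb; case: eqP => // <-.
  by case: eqP => // /esym.
rewrite -mulnn big_distrlr /=.
(* Cauchy-Schwarz comes from summing 2 n(a) n(b) <= n(a)^2 + n(b)^2 over all pairs (a, b). *)
have [E1 E2] : (\sum_(a <- s) \sum_(b <- s) n a ^ 2 = size s * \sum_(a <- s) n a ^ 2)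
    /\ (\sum_(a <- s) \sum_(b <- s) n b ^ 2 = size s * \sum_(a <- s) n a ^ 2).
  rewrite exchange_big /=.
  by split; rewrite big_const_seq count_predT iter_addn_0 mulnC.
rewrite -(leq_pmul2l (m := 2)) // [X in _ <= X]mul2n -addnn -{1}E1 -E2 -big_split /=.
rewrite big_distrr; apply: leq_sum => a _; rewrite -big_split big_distrr.
by apply: leq_sum => b _; rewrite /= nat_Cauchy.
Qed.

Lemma card_le_fibers (T S : finType) (A : {set T}) (h : T -> S) (k : nat) :
    (forall x, x \in A -> #|[set y in A | h y == h x]| <= k) ->
  #|A| <= k * #|S|.
Proof.
move=> hk; rewrite -sum1_card (partition_big h xpredT) //= mulnC -sum_nat_const.
apply: leq_sum => s _; rewrite sum1_card.
case: (pickP [pred x in A | h x == s]) => [x /andP[xA /eqP <-]|no].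
  by apply: leq_trans (hk x xA); apply/eq_leq/eq_card => y; rewrite inE.
by rewrite (eq_card (B := pred0)) ?card0.
Qed.

(** * Collisions among scaled primes *)

(* Three copies of the odd primes, scaled by 1, 1 and 2: this stands for giving
   weight 2 to [l] and weight 1 to [2 * l]. *)
Definition copy_factor (c : 'I_3) : nat := (c == 2 :> nat).+1.

Definition scaled_primes (p : nat) : {set 'I_3 * 'I_p} :=
  [set x : 'I_3 * 'I_p | [&& prime x.2, odd x.2 & copy_factor x.1 * x.2 < p]].

Definition scaled_value (p : nat) (x : 'I_3 * 'I_p) : nat :=
  copy_factor x.1 * x.2.

Lemma scaled_value_bounds (p : nat) (x : 'I_3 * 'I_p) :
  x \in scaled_primes p -> 0 < scaled_value x < p.
Proof.
by rewrite inE /scaled_value => /and3P[/prime_gt0 l0 _ ->]; rewrite muln_gt0 l0.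
Qed.

(** With factors 1, 1, 2, the ratio 1 arises from 2^2 + 1^2 = 5 pairs, the ratios 2 and 1/2 from two
    pairs each. *)
Lemma card_copy_ratio (a b : 'I_3) :
  #|[set cd : 'I_3 * 'I_3 |
      copy_factor cd.1 * copy_factor b == copy_factor a * copy_factor cd.2]| <= 5.
Proof.
rewrite -sum1_card big_mkcond /=.
rewrite (eq_bigr (fun cd : 'I_3 * 'I_3 => if copy_factor cd.1 * copy_factor b ==
  copy_factor a * copy_factor cd.2 then 1 else 0)); last first.
  by move=> cd _; rewrite inE.
rewrite -(pair_bigA _ (fun c d => if copy_factor c * copy_factor b ==
  copy_factor a * copy_factor d then 1 else 0)) /=.
rewrite !big_ord_recl !big_ord0 /copy_factor /=.
by case: (a == 2 :> nat); case: (b == 2 :> nat).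
Qed.

Lemma odd_prime_dvd_copy_factor (l : nat) (c : 'I_3) :
  prime l -> odd l -> (l %| copy_factor c) = false.
Proof.
move=> pl ol; rewrite gtnNdvd // /copy_factor.
have := prime_gt1 pl; have : l != 2 by apply: contraTneq ol => ->.
by case: (c == 2 :> nat) => /=; lia.
Qed.

(** An odd prime divides no copy factor, so [l] survives in the reduced numerator and [m] in the
    reduced denominator. *)
Lemma scaled_ratio_inj (c d c' d' : 'I_3) (l m l' m' : nat) :
    prime l -> odd l -> prime m -> odd m -> prime l' -> prime m' -> l != m ->
    (copy_factor c * l) * (copy_factor d' * m') =
    (copy_factor c' * l') * (copy_factor d * m) ->
  [/\ l' = l, m' = m & copy_factor c' * copy_factor d = copy_factor c * copy_factor d'].
Proof.
move=> pl ol pm om pl' pm' nlm E.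
have El : l' = l.
  have : l %| (copy_factor c' * l') * (copy_factor d * m).
    by rewrite -E dvdn_mulr // dvdn_mull.
  rewrite !Euclid_dvdM // !odd_prime_dvd_copy_factor //= !dvdn_prime2 //.
  by rewrite (negPf nlm) orbF => /eqP.
have Em : m' = m.
  have : m %| (copy_factor c * l) * (copy_factor d' * m').
    by rewrite E dvdn_mull // dvdn_mull.
  rewrite !Euclid_dvdM // !odd_prime_dvd_copy_factor //= !dvdn_prime2 //.
  by rewrite eq_sym (negPf nlm) => /eqP.
split=> //; apply/eqP; rewrite -(eqn_pmul2r (m := l * m)).
  by rewrite mulnACA -{1}El -E Em -mulnACA eqxx.
by rewrite muln_gt0 !prime_gt0.
Qed.

(** Collisions with a common prime ([D]) are fixed by the first point and the copy of the second,
    whence the factor 3. The others ([O]) are grouped by their ratio modulo p into p fibers. *)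
Lemma card_scaled_collisions (p : nat) : prime p ->
  #|[set xy : ('I_3 * 'I_p) * ('I_3 * 'I_p) |
      [&& xy.1 \in scaled_primes p, xy.2 \in scaled_primes p &
        fermat_quotient p (scaled_value xy.1)
          == fermat_quotient p (scaled_value xy.2)]]|
  <= 3 * #|scaled_primes p| + 5 * p.
Proof.
move=> pp; set C := [set _ | _].
pose D := [set xy in C | xy.1.2 == xy.2.2].
pose O := [set xy in C | xy.1.2 != xy.2.2].
have -> : C = D :|: O.
  by apply/setP=> xy; rewrite !inE -andb_orr orbN andbT.
apply: leq_trans (leq_card_setU _ _) _; apply: leq_add.
  have inj : {in D &, injective (fun xy : ('I_3 * 'I_p) * ('I_3 * 'I_p) =>
      (xy.1, xy.2.1))}.
    move=> [[a b] [c d]] [[a' b'] [c' d']]; rewrite !inE /=.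
    by move=> /andP[_ /eqP <-] /andP[_ /eqP <-] [-> -> ->].
  rewrite -(card_in_imset inj) mulnC -[X in _ * X]card_ord -[#|'I_3|]cardsT -cardsX.
  apply/subset_leq_card/subsetP=> _ /imsetP[xy + ->].
  by rewrite !inE => /andP[/and3P[-> _ _] _].
pose ratio (xy : ('I_3 * 'I_p) * ('I_3 * 'I_p)) : 'I_p :=
  Ordinal (ltn_pmod (scaled_value xy.1 * scaled_value xy.2 ^ (p - 2)) (prime_gt0 pp)).
rewrite -[X in 5 * X]card_ord; apply: (@card_le_fibers _ _ _ ratio) => -[[a l0] [b m0]] xyO.
pose K := [set cd : 'I_3 * 'I_3 |
  copy_factor cd.1 * copy_factor b == copy_factor a * copy_factor cd.2].
pose g (cd : 'I_3 * 'I_3) := ((cd.1, l0), (cd.2, m0)).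
(* All pairs in one fiber share the primes [l0] and [m0]; only their copies vary. *)
apply: (@leq_trans #|g @: K|); last first.
  by apply: leq_trans (leq_imset_card _ _) (card_copy_ratio _ _).
apply/subset_leq_card/subsetP=> -[[c l] [d m]].
rewrite [in X in X -> _]inE => /andP[lmO /eqP /(congr1 val) /= er].
rewrite !inE /= in xyO lmO.
case/andP: xyO lmO => [/and3P[xX yX /eqP q1] nxy] /andP[/and3P[x'X y'X /eqP q2] _].
have E := collision_ratio pp
  (scaled_value_bounds (x := (c, l)) _) (scaled_value_bounds (x := (d, m)) _)
  (scaled_value_bounds (x := (a, l0)) _) (scaled_value_bounds (x := (b, m0)) _)
  q2 q1 er.
rewrite !inE in E; move: {E}(E x'X y'X xX yX) => /esym E.
case/and3P: xX yX x'X y'X => /= pl ol _ /and3P[pm om _] /and3P[pl' _ _] /and3P[pm' _ _].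
have [El Em Ef] := scaled_ratio_inj pl ol pm om pl' pm' nxy E.
apply/imsetP; exists (c, d); first by rewrite inE /= Ef.
by rewrite /g /=; congr ((_, _), (_, _)); apply: val_inj.
Qed.

Lemma M_ge_scaled (p : nat) : prime p ->
  #|scaled_primes p| ^ 2 <= M p * (3 * #|scaled_primes p| + 5 * p).
Proof.
move=> pp; apply: leq_trans (leq_mul (leqnn _) (card_scaled_collisions pp)).
apply: (@card_sqr_le_collisions _ _ _ (fun x => fermat_quotient p (scaled_value x))).
  exact: undup_uniq.
move=> x /scaled_value_bounds /andP[_ lt_xp].
by rewrite mem_undup map_f // mem_iota.
Qed.

(** * Size of the set of scaled primes *)

Definition prime_count (n : nat) : nat := \sum_(0 <= l < n) prime l.

Lemma prime_count_odd (n : nat) :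
  prime_count n <= \sum_(0 <= l < n) (prime l && odd l) + 1.
Proof.
apply: (@leq_trans (\sum_(0 <= l < n) ((prime l && odd l) + (l == 2)))).
  apply: leq_sum => l _; case: (boolP (prime l)) => //= pl.
  by case: (even_prime pl) => [->|->].
rewrite big_split leq_add2l.
suff -> : \sum_(0 <= l < n) (l == 2) = (2 < n) by case: (2 < n).
by elim: n => [|n IHn]; [rewrite big_geq | rewrite big_nat_recr //= IHn; lia].
Qed.

(** The doubled copy keeps the primes with 2 l < p, that is l < [uphalf p]. The prime 2 is lost at
    most once in each copy, hence the 3. *)
Lemma card_scaled_primes (p : nat) :
  2 * prime_count p + prime_count (uphalf p) <= #|scaled_primes p| + 3.
Proof.
pose o n := \sum_(0 <= l < n) (prime l && odd l).
suff -> : #|scaled_primes p| = 2 * o p + o (uphalf p).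
  have := prime_count_odd p; have := prime_count_odd (uphalf p).
  by rewrite -/(o _) -/(o _); lia.
pose F (c : 'I_3) (l : 'I_p) : nat := [&& prime l, odd l & copy_factor c * l < p].
have -> : #|scaled_primes p| = \sum_c \sum_l F c l.
  rewrite pair_bigA /= -sum1_card big_mkcond /=.
  by apply: eq_bigr => x _; rewrite inE /F; case: [&& _, _ & _].
rewrite !big_ord_recl big_ord0 addn0 addnA; congr (_ + _).
  rewrite mul2n -addnn /o big_mkord.
  by congr (_ + _); apply: eq_bigr => l _; rewrite /F /copy_factor /= mul1n ltn_ord andbT.
have le : uphalf p <= p by rewrite uphalf_half; lia.
rewrite /o big_mkord (big_ord_widen _ (fun l => nat_of_bool (prime l && odd l)) le).
rewrite [RHS]big_mkcond; apply: eq_bigr => l _; rewrite /F /copy_factor /=.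
have -> : (2 * l < p) = (l < uphalf p) by lia.
by case: (l < _); rewrite ?andbT ?andbF.
Qed.

(** * Chebyshev's factorial ratio *)

(** Since 1 + 1/30 = 1/2 + 1/3 + 1/5, the difference of the floor sums has period 30, and it never
    exceeds 1. *)
Lemma floor_chebyshev (y : nat) : y + y %/ 30 <= y %/ 2 + y %/ 3 + y %/ 5 + (0 < y).
Proof. lia. Qed.

Lemma logn_fact_widen (l n N : nat) :
  prime l -> n <= N -> logn l n`! = \sum_(1 <= k < N.+1) n %/ l ^ k.
Proof.
move=> pl le_nN; rewrite logn_fact // [RHS](@big_cat_nat _ _ _ n.+1) //=.
rewrite [X in _ + X]big_nat [X in _ + X]big1 ?addn0 // => k /andP[lt_nk _].
by rewrite divn_small // (leq_trans lt_nk) // ltnW // ltn_expl // prime_gt1.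
Qed.

Lemma sum_expn_le (l N : nat) : 1 < l -> 0 < N ->
  \sum_(1 <= k < N.+1) (0 < N %/ l ^ k) <= trunc_log l N.
Proof.
move=> l1 N0; set t := trunc_log l N.
have le_tN : t <= N.
  by apply: leq_trans (trunc_logP l1 N0); apply/ltnW/ltn_expl.
rewrite (@big_cat_nat _ _ _ t.+1) //= [X in _ + X]big_nat [X in _ + X]big1.
  rewrite addn0; apply: (@leq_trans (\sum_(1 <= k < t.+1) 1)).
    by apply: leq_sum => k _; apply: leq_b1.
  by rewrite sum_nat_const_nat muln1 subn1.
move=> k /andP[lt_tk _]; rewrite divn_small //.
by apply: leq_trans (trunc_log_ltn N l1) _; rewrite leq_exp2l.
Qed.

(** Legendre's formula reduces this to [floor_chebyshev] at y = 30n %/ l^k for each k; the excess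
    counts the powers of [l] up to 30n. *)
Lemma chebyshev_logn (l n : nat) : prime l -> 0 < n ->
  logn l ((30 * n)`! * n`!) <=
  logn l ((15 * n)`! * (10 * n)`! * (6 * n)`!) + trunc_log l (30 * n).
Proof.
move=> pl n0; set N := 30 * n.
have N0 : 0 < N by rewrite /N; lia.
rewrite !lognM ?muln_gt0 ?fact_gt0 //.
rewrite !(@logn_fact_widen l _ N) //; try by rewrite /N; lia.
apply: leq_trans (leq_add (leqnn _) (sum_expn_le (prime_gt1 pl) N0)).
rewrite -!big_split; apply: leq_sum => k _ /=.
have E m d : 0 < d -> N = m * d -> m %/ l ^ k = (N %/ l ^ k) %/ d.
  by move=> d0 ->; rewrite divnAC mulnK.
rewrite (E n 30) ?(E (15 * n) 2) ?(E (10 * n) 3) ?(E (6 * n) 5) //; try by rewrite /N; lia.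
exact: floor_chebyshev.
Qed.

Lemma chebyshev_fact (n : nat) : 0 < n ->
  (30 * n)`! * n`! <=
  (15 * n)`! * (10 * n)`! * (6 * n)`! * (30 * n) ^ prime_count (30 * n).+1.
Proof.
move=> n0; set N := 30 * n; set D := (15 * n)`! * _ * _.
have N0 : 0 < N by rewrite /N; lia.
(* [L] is the lcm of 1, ..., N: a product of pi(N) prime powers, each at most N. *)
pose L := \prod_(0 <= l < N.+1 | prime l) l ^ trunc_log l N.
have D0 : 0 < D by rewrite !muln_gt0 !fact_gt0.
have L0 : 0 < L.
  by rewrite /L; apply: prodn_cond_gt0 => l pl; rewrite expn_gt0 prime_gt0.
have leL : L <= N ^ prime_count N.+1.
  rewrite /prime_count expn_sum /L big_mkcond; apply: leq_prod => l _.
  by case: ifP => // pl; rewrite expn1 trunc_logP // prime_gt1.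
apply: leq_trans (leq_mul (leqnn D) leL); apply: dvdn_leq; first by rewrite muln_gt0 D0.
apply/dvdn_partP => [|l]; first by rewrite muln_gt0 !fact_gt0.
rewrite mem_primes => /and3P[pl _ _].
rewrite p_part pfactor_dvdn //; last by rewrite muln_gt0 D0.
apply: leq_trans (chebyshev_logn pl n0) _.
rewrite -/D (lognM _ D0 L0) leq_add2l -/N; case: (leqP l N) => [le_lN|lt_Nl].
  rewrite -(pfactor_dvdn _ pl L0) /L.
  by rewrite big_mkcond (bigD1_seq l) ?mem_index_iota ?iota_uniq //= pl dvdn_mulr.
suff /eqP-> : trunc_log l N == 0 by [].
by rewrite trunc_log_eq0; apply/orP; right; lia.
Qed.

(** * Logarithms and an elementary Stirling bound *)

Section RealEstimates.

Local Open Scope R_scope.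

Lemma INR_muln (m n : nat) : INR (m * n)%N = INR m * INR n.
Proof. exact: mult_INR. Qed.

Lemma INR_addn (m n : nat) : INR (m + n)%N = INR m + INR n.
Proof. exact: plus_INR. Qed.

Lemma INR_expn (m n : nat) : INR (m ^ n)%N = INR m ^ n.
Proof. by elim: n => [|n IHn] //; rewrite expnS INR_muln IHn. Qed.

Lemma INR_leq (m n : nat) : (m <= n)%N -> INR m <= INR n.
Proof. by move/leP/le_INR. Qed.

Lemma INR_gt0 (n : nat) : (0 < n)%N -> 0 < INR n.
Proof. by move/ltP/lt_0_INR. Qed.

Lemma ln_le_sub1 (y : R) : 0 < y -> ln y <= y - 1.
Proof.
move=> y0; have := exp_ineq1_le (ln y); rewrite exp_ln //; lra.
Qed.

Lemma ln_le_mono (x y : R) : 0 < x -> x <= y -> ln x <= ln y.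
Proof.
by move=> x0 [xy|->]; [apply/Rlt_le/ln_increasing|apply: Rle_refl].
Qed.

Lemma ln_quot (x y : R) : 0 < x -> 0 < y -> ln (x / y) = ln x - ln y.
Proof.
move=> x0 y0; rewrite /Rdiv ln_mult ?ln_Rinv //; exact: Rinv_0_lt_compat.
Qed.

Lemma ln_succ_bounds (x : R) : 0 < x ->
  x * (ln (x + 1) - ln x) <= 1 /\ 1 <= (x + 1) * (ln (x + 1) - ln x).
Proof.
move=> x0; split.
- have := @ln_le_sub1 ((x + 1) / x) ltac:(apply: Rdiv_lt_0_compat; lra).
  rewrite ln_quot; try lra; move=> /(Rmult_le_compat_l x _ _ (Rlt_le _ _ x0)).
  by have -> : x * ((x + 1) / x - 1) = 1 by field; lra.
- have := @ln_le_sub1 (x / (x + 1)) ltac:(apply: Rdiv_lt_0_compat; lra).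
  rewrite ln_quot; try lra; move=> /(Rmult_le_compat_l (x + 1) _ _ ltac:(lra)).
  have -> : (x + 1) * (x / (x + 1) - 1) = -1 by field; lra.
  lra.
Qed.

Lemma ln_fact_bounds (n : nat) : (0 < n)%N ->
  INR n * ln (INR n) - INR n <= ln (INR n`!) <=
  INR n * ln (INR n) - INR n + ln (INR n) + 1.
Proof.
case: n => // n _; elim: n => [|n [IHl IHu]].
  rewrite /= ln_1; lra.
rewrite factS INR_muln ln_mult; try by apply: INR_gt0; rewrite ?fact_gt0.
have x0 : 0 < INR n.+1 by apply: INR_gt0.
have [l1 l2] := ln_succ_bounds x0.
rewrite (S_INR n.+1); nra.
Qed.

Lemma expR_pow (x : R) (n : nat) : exp x ^ n = exp (INR n * x).
Proof.
elim: n => [|n IHn]; first by rewrite /= Rmult_0_l exp_0.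
by rewrite S_INR Rmult_plus_distr_r Rmult_1_l exp_plus -IHn /= Rmult_comm.
Qed.

(** * Chebyshev's lower bound for the number of primes *)

(** The right side is 30 ln 30 - 15 ln 15 - 10 ln 10 - 6 ln 6, the growth rate in n of the logarithm
    of the factorial ratio; 27/30 = 0.9. The rough bound e <= (32/31)^32 <= 2.77 suffices. *)
Lemma chebyshev_const : 27 <= 14 * ln 2 + 9 * ln 3 + 5 * ln 5.
Proof.
have e1 : exp 1 <= 277 / 100.
  have -> : exp 1 = exp (1 / 32) ^ 32.
    by rewrite expR_pow; congr exp; simpl; field.
  have e32 : exp (1 / 32) <= 32 / 31.
    have := exp_ineq1_le (- (1 / 32)); rewrite exp_Ropp => h.
    have h0 := exp_pos (1 / 32).
    have : / exp (1 / 32) * exp (1 / 32) = 1 by field; lra.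
    nra.
  apply: (Rle_trans _ ((32 / 31) ^ 32)).
    by apply: pow_incr; split=> //; apply/Rlt_le/exp_pos.
  simpl; lra.
have e27 : exp 27 <= 2 ^ 14 * 3 ^ 9 * 5 ^ 5.
  have -> : exp 27 = exp 1 ^ 27.
    by rewrite expR_pow; congr exp; simpl; ring.
  apply: (Rle_trans _ ((277 / 100) ^ 27)).
    by apply: pow_incr; split=> //; apply/Rlt_le/exp_pos.
  simpl; lra.
have := ln_le_mono (exp_pos 27) e27.
have pw k n : 0 < k -> 0 < k ^ n by apply: pow_lt.
have [p2 p3 p5] : [/\ 0 < 2 ^ 14, 0 < 3 ^ 9 & 0 < 5 ^ 5] by split; apply: pw; lra.
rewrite ln_exp (ln_mult _ _ (Rmult_lt_0_compat _ _ p2 p3) p5) (ln_mult _ _ p2 p3).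
by rewrite !ln_pow; simpl; lra.
Qed.

(** As 30 + 1 = 15 + 10 + 6, the n ln n and n terms of Stirling cancel; each of the three
    denominators costs at most ln(30n) + 1. *)
Lemma chebyshev_mul30 (n : nat) : (0 < n)%N ->
  27 * INR n - 3 * ln (INR (30 * n)%N) - 3 <=
  INR (prime_count (30 * n).+1) * ln (INR (30 * n)%N).
Proof.
move=> n0; have nR := INR_gt0 n0.
have kn k : (0 < k)%N -> (0 < k * n)%N by rewrite muln_gt0 n0 andbT.
have f0 m : 0 < INR m`! by apply: INR_gt0; rewrite fact_gt0.
have ln_kn k : (0 < k)%N -> ln (INR (k * n)%N) = ln (INR k) + ln (INR n).
  by move=> k0; rewrite INR_muln ln_mult //; apply: INR_gt0.
have := INR_leq (chebyshev_fact n0).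
move: (prime_count _) => c; rewrite 4!INR_muln INR_expn.
move/(ln_le_mono (Rmult_lt_0_compat _ _ (f0 _) (f0 _))).
have N0 : 0 < INR (30 * n)%N ^ c by apply/pow_lt/INR_gt0/kn.
rewrite !ln_mult ?ln_pow //; try by do ?apply: Rmult_lt_0_compat.
  have [] := (ln_fact_bounds n0, ln_fact_bounds (kn 30%N isT)).
  have [] := (ln_fact_bounds (kn 15%N isT), ln_fact_bounds (kn 10%N isT)).
  have := ln_fact_bounds (kn 6%N isT).
  rewrite !ln_kn // !INR_muln.
  have -> : INR 30 = 2 * 3 * 5 by simpl; ring.
  have -> : INR 15 = 3 * 5 by simpl; ring.
  have -> : INR 10 = 2 * 5 by simpl; ring.
  have -> : INR 6 = 2 * 3 by simpl; ring.
  rewrite !ln_mult; try lra.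
  have := Rmult_le_compat_l _ _ _ (Rlt_le _ _ nR) chebyshev_const.
  have ln_pos x : 1 < x -> 0 < ln x by move=> x1; rewrite -ln_1; apply: ln_increasing; lra.
  have := ln_pos 2 ltac:(lra); have := ln_pos 3 ltac:(lra); have := ln_pos 5 ltac:(lra).
  lra.
exact/INR_gt0/kn.
Qed.

Lemma prime_count_mono (m n : nat) : (m <= n)%N -> (prime_count m <= prime_count n)%N.
Proof. by move=> le_mn; rewrite /prime_count (big_cat_nat _ le_mn) //= leq_addr. Qed.

(** The separate [x] lets pi(p) and pi(p/2) be measured against the same ln p. *)
Lemma chebyshev_lower (p : nat) (x : R) : (0 < p)%N -> INR p <= x ->
  9 / 10 * INR p - 30 - 3 * ln x <= INR (prime_count p) * ln x.
Proof.
(* The shift by 1 gives 30n + 1 <= p <= 30n + 30, as [prime_count] has a strict bound. Rounding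
   costs 0.9 * 30 = 27, which with the 3 of [chebyshev_mul30] makes 30. *)
move=> p0 px; set n := ((p - 1) %/ 30)%N.
have p1 : 1 <= INR p by apply: (INR_leq p0).
have lx : 0 <= ln x by rewrite -ln_1; apply: ln_le_mono; lra.
have pn : INR p <= 30 * INR n + 30.
  have -> : 30 * INR n + 30 = INR (30 * n + 30)%N.
    by rewrite INR_addn INR_muln; simpl; ring.
  by apply: INR_leq; rewrite /n; lia.
have pc0 := pos_INR (prime_count p).
case: (posnP n) => [n0|n0]; first by move: pn; rewrite n0 /=; nra.
have lnN : ln (INR (30 * n)%N) <= ln x.
  apply: ln_le_mono; first by apply: INR_gt0; rewrite muln_gt0.
  by apply: Rle_trans px; apply: INR_leq; rewrite /n; lia.
have lnN0 : 0 <= ln (INR (30 * n)%N).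
  by rewrite -ln_1; apply: ln_le_mono; [lra | apply: (@INR_leq 1); rewrite muln_gt0].
have := chebyshev_mul30 n0.
have : INR (prime_count (30 * n).+1) <= INR (prime_count p).
  by apply/INR_leq/prime_count_mono; rewrite /n; lia.
have := pos_INR (prime_count (30 * n).+1).
nra.
Qed.

(** * The lower bound for M(p) *)

(** The constants are 9/4 = 0.9 * (2 + 1/2), 90 = 3 * 30 and 12 = 3 * 3 + 3, the last 3 coming from
    [card_scaled_primes]. *)
Lemma card_scaled_primes_lower (p : nat) : (1 < p)%N ->
  9 / 4 * INR p - 90 - 12 * ln (INR p) <= INR #|scaled_primes p| * ln (INR p).
Proof.
move=> p1; have px : 1 <= INR p by apply/(@INR_leq 1)/ltnW.
have lp : 0 <= ln (INR p) by rewrite -ln_1; apply: ln_le_mono; lra.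
have := chebyshev_lower (ltnW p1) (Rle_refl _).
have h0 : (0 < uphalf p)%N by lia.
have h1 : (uphalf p <= p)%N by lia.
have := chebyshev_lower h0 (INR_leq h1).
have : INR p <= 2 * INR (uphalf p).
  by have -> : 2 = INR 2 by []; rewrite -INR_muln; apply: INR_leq; lia.
have := INR_leq (card_scaled_primes p); rewrite (INR_addn _ 3) (INR_addn (2 * _)%N) INR_muln.
have -> : INR 2 = 2 by []; have -> : INR 3 = 3 by simpl; ring.
move=> /(Rmult_le_compat_r _ _ _ lp); lra.
Qed.

Lemma M_lower (p : nat) : prime p -> 5000 <= ln (INR p) ->
  INR p / ln (INR p) ^ 2 <= INR (M p).
Proof.
move=> pp; have p0 := INR_gt0 (prime_gt0 pp).
have := card_scaled_primes_lower (prime_gt1 pp).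
have := INR_leq (M_ge_scaled pp).
rewrite INR_expn INR_muln INR_addn !INR_muln.
have -> : INR 5 = 5 by simpl; ring. have -> : INR 3 = 3 by simpl; ring.
move=> hM hA hL; have pL : (1 + ln (INR p) / 2) ^ 2 <= INR p.
  have e2 : exp (ln (INR p) / 2) ^ 2 = INR p.
    by rewrite expR_pow -[RHS]exp_ln //; congr exp; simpl; field.
  rewrite -[X in _ <= X]e2; apply: pow_incr.
  by have := exp_ineq1_le (ln (INR p) / 2); lra.
move: hM hA hL pL (pos_INR (M p)) (pos_INR #|scaled_primes p|).
move: (INR p) p0 (ln _) (INR (M p)) (INR #|_|) => x x0 L m a hM hA hL pL m0 a0.
(* By [pL], x/100 >= L^2/400 >= 12.5 L, which covers 12 L + 90 once L >= 5000. *)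
have aL : 224 / 100 * x <= a * L by nra.
apply: (Rmult_le_reg_r (L ^ 2)); first by apply: pow_lt; lra.
have -> : x / L ^ 2 * L ^ 2 = x by field; lra.
case: (Rle_lt_dec x (m * L ^ 2)) => // lt_mx; exfalso.
have : (a * L) ^ 2 <= x * (3 * a + 5 * x).
  apply: (Rle_trans _ (m * L ^ 2 * (3 * a + 5 * x))).
    have := Rmult_le_compat_r _ _ _ (pow2_ge_0 L) hM; lra.
  by apply: Rmult_le_compat_r; lra.
(* The margin 2.24^2 = 5.0176 > 5 absorbs the term 3 a <= (3/5000) a L and gives the
   contradiction. *)
have : 5000 * a <= a * L by nra.
nra.
Qed.

End RealEstimates.

(* M(p) >= (1 + o(1)) p / (log p)^2 as p -> oo over primes. *)
Theorem theorem10 :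
  forall eps : R, (0 < eps)%R ->
  exists P : nat, forall p : nat, prime p -> (P <= p)%N ->
    ((1 - eps) * INR p / (ln (INR p) ^ 2) <= INR (M p))%R.
Proof.
(* From e^5000 on, [M_lower] gives the bound with constant 1, and the factor 1 - eps only lowers the
   left side. *)
move=> eps eps0; have [P hP] := INR_unbounded (exp 5000).
exists P => p pp /INR_leq le_Pp.
have L5 : (5000 <= ln (INR p))%R.
  rewrite -(ln_exp 5000); apply: ln_le_mono; [exact: exp_pos | lra].
apply: Rle_trans (M_lower pp L5).
have q0 : (0 <= INR p / ln (INR p) ^ 2)%R.
  apply: Rle_mult_inv_pos; [exact: pos_INR | apply: pow_lt; lra].
rewrite /Rdiv Rmult_assoc -/(Rdiv _ _); nra.
Qed.
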